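(* Let $\theta\in\Theta=(\alpha,\beta)$ be fixed, and suppose that, under $\mathbf{P}_\theta^{(n)}$, the normalized likelihood ratio processes $Z_n$ converge weakly, as $n\to+\infty$, in the space $\mathcal{D}_0^{(M_1)}(\mathbb{R})$ to a process $Z$ with trajectories in $\mathcal{D}_0(\mathbb{R})$. Suppose moreover that, almost surely, the equation $$\max\{Z(\eta-),Z(\eta)\}=\sup_{u\in\mathbb{R}}Z(u)$$ has a unique solution $\eta\in\mathbb{R}$, denoted $\eta=\operatorname{argsup}_{u\in\mathbb{R}}Z(u)$. Then the maximum likelihood estimator $\hat\theta_n$ satisfies, under $\mathbf{P}_\theta^{(n)}$, the convergence in distribution $$\varphi_n^{-1}(\hat\theta_n-\theta)\Longrightarrow\eta\qquad(n\to+\infty).$$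
   Context: $\mathcal{D}_0(\mathbb{R})$ is the space of càdlàg functions on $\mathbb{R}$ vanishing at $\pm\infty$. The topology $M_1$ on $\mathcal{D}_0(\mathbb{R})$: for $f\in\mathcal{D}_0(\mathbb{R})$ the graph is $\Gamma_f=\{(u,v)\in\mathbb{R}^2: u\in\mathbb{R},\ v\in[f(u-),f(u)]\}$, where $[a,b]$ means $[b,a]$ if $b<a$. On $\Gamma_f$ put $(u_1,v_1)\leq(u_2,v_2)$ if either $u_1<u_2$, or $u_1=u_2$ and $|f(u_1-)-v_1|\leq|f(u_1-)-v_2|$. A parametric representation of $\Gamma_f$ is a pair $(t,y)$ of continuous functions on $\mathbb{R}$ such that $s\mapsto(t(s),y(s))$ maps $\mathbb{R}$ onto $\Gamma_f$ and is increasing: $(t(s),y(s))\leq(t(s'),y(s'))$ whenever $s\leq s'$. The topology $M_1$ is induced by the distance $$d^{(M_1)}(f,g)=\inf\ \sup_{s\in\mathbb{R}}\bigl(|t_1(s)-t_2(s)|+|y_1(s)-y_2(s)|\bigr),$$ the infimum being over all pairs of parametric representations $(t_1,y_1)$ of $\Gamma_f$ and $(t_2,y_2)$ of $\Gamma_g$. $\mathcal{D}_0^{(M_1)}(\mathbb{R})$ denotes $\mathcal{D}_0(\mathbb{R})$ with this topology. Weak convergence is convergence of expectations of bounded continuous functionals. Statistical setting: for each $n\in\mathbb{N}^*=\{1,2,\dots\}$ one observes $X^{(n)}$ with distribution $\mathbf{P}_\theta^{(n)}$, $\theta\in\Theta=(\alpha,\beta)\subset\mathbb{R}$, with likelihood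 $L(\theta,X^{(n)})$ with respect to some reference measure, and $t\mapsto L(t,X^{(n)})$ is càdlàg on $\Theta$. Put $L^\pm(t,X^{(n)})=\max\{L(t-,X^{(n)}),L(t,X^{(n)})\}$. The maximum likelihood estimator $\hat\theta_n$ is any ($\Theta$-valued random variable which is a) solution of $L^\pm(\hat\theta_n,X^{(n)})=\sup_{t\in\Theta}L(t,X^{(n)})$. With a sequence $\varphi_n\searrow0$ and $\mathbb{U}_n=(u_n^-,u_n^+)=(\varphi_n^{-1}(\alpha-\theta),\varphi_n^{-1}(\beta-\theta))$, the normalized likelihood ratio is $Z_n(u)=L(\theta+u\varphi_n,X^{(n)})/L(\theta,X^{(n)})$, $u\in\mathbb{U}_n$. It is extended to the whole real line as a nonnegative process with trajectories in $\mathcal{D}_0(\mathbb{R})$ which decrease (in the wide sense) to $0$ as $u$ moves away from $\mathbb{U}_n$ on either side: $Z_n$ is nonincreasing on $[u_n^+,+\infty)$ with $Z_n(u_n^+)\leq Z_n(u_n^+-)$, and nondecreasing on $(-\infty,u_n^-]$ (so that $\sup_{\mathbb{R}}Z_n=\sup_{\mathbb{U}_n}Z_n$). *)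

(* Defs.v *)
From HB Require Import structures.
From mathcomp Require Import all_boot all_order all_algebra.
From mathcomp Require Import all_classical all_reals all_analysis.

Set Implicit Arguments.
Unset Strict Implicit.
Unset Printing Implicit Defensive.

Import Order.TTheory GRing.Theory Num.Theory.
Import numFieldNormedType.Exports.

Local Open Scope classical_set_scope.
Local Open Scope ring_scope.

Definition left_limit (R : realType) (f : R -> R) (u : R) : R :=
  lim (f x @[x --> u^'-]).

(* Meant for open [A]: the one-sided limits are those of [f] on the line. *)
Definition cadlag_on (R : realType) (A : set R) (f : R -> R) : Prop :=
  forall u, A u ->
    f x @[x --> u^'+] --> f u /\ cvg (f x @[x --> u^'-]).

Record D0 (R : realType) : Type := MkD0 {
  D0_fun :> R -> R ;
  D0_cadlag : cadlag_on [set: R] D0_fun ;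
  D0_cvgy : D0_fun x @[x --> +oo] --> (0 : R) ;
  D0_cvgNy : D0_fun x @[x --> -oo] --> (0 : R) }.

HB.instance Definition _ (R : realType) := gen_eqMixin (D0 R).
HB.instance Definition _ (R : realType) := gen_choiceMixin (D0 R).

Section M1.
Context {R : realType}.
Implicit Types (f g : D0 R) (p q : R * R) (t y : R -> R).

(* Completed graph: the jumps are filled in by vertical segments. *)
Definition graph f : set (R * R) :=
  [set p | Num.min (left_limit f p.1) (f p.1) <= p.2
           <= Num.max (left_limit f p.1) (f p.1)].

Definition graph_le f p q : Prop :=
  p.1 < q.1 \/
  (p.1 = q.1 /\
   `|left_limit f p.1 - p.2| <= `|left_limit f p.1 - q.2|).

Definition parametric_representation f t y : Prop :=
  [/\ continuous t, continuous y,
      range (fun s => (t s, y s)) = graph f &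
      forall s s', s <= s' -> graph_le f (t s, y s) (t s', y s')].

(* Extended-real valued, so that the supremum and the infimum need no
   boundedness side condition (some pairs of representations are at infinite
   distance from each other). *)
Definition dist_M1 f g : \bar R :=
  ereal_inf [set e : \bar R | exists t1 y1 t2 y2,
    [/\ parametric_representation f t1 y1,
        parametric_representation g t2 y2 &
        e = ereal_sup (range (fun s : R =>
              (`|t1 s - t2 s| + `|y1 s - y2 s|)%:E))]].

Definition M1_open (O : set (D0 R)) : Prop :=
  forall f, O f ->
    exists2 e : R, 0 < e & forall g, (dist_M1 f g < e%:E)%E -> O g.

Lemma M1_openT : M1_open setT.
Proof. by move=> f _; exists 1. Qed.

Lemma M1_openI (A B : set (D0 R)) :
  M1_open A -> M1_open B -> M1_open (A `&` B).
Proof.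
move=> oA oB f [/oA[a a0 Aa] /oB[b b0 Bb]].
exists (Num.min a b); first by rewrite lt_min a0.
move=> g; rewrite EFin_min lt_min => /andP[ga gb].
by split; [exact: Aa|exact: Bb].
Qed.

Lemma M1_open_bigU (I : Type) (A : I -> set (D0 R)) :
  (forall i, M1_open (A i)) -> M1_open (\bigcup_i A i).
Proof.
move=> oA f [i _ /oA[e e0 Ae]]; exists e => // g fg.
by exists i => //; exact: Ae.
Qed.

End M1.

(* The topology of [D0 R] is M1. *)
HB.instance Definition _ (R : realType) :=
  isOpenTopological.Build (D0 R) (@M1_openT R) (@M1_openI R) (@M1_open_bigU R).

(* Measurability with respect to the Borel sigma-algebra of [T]. *)
Definition random_element d (S : measurableType d) (T : topologicalType)
    (Y : S -> T) : Prop :=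
  forall B : set T, <<s @open T >> B -> measurable (Y @^-1` B).

(* The [Y n] may live on different probability spaces. *)
Definition weak_cvg (R : realType) (T : topologicalType)
    (d : nat -> measure_display) (S : forall n, measurableType (d n))
    (P : forall n, probability (S n) R) (Y : forall n, S n -> T)
    (d' : measure_display) (S' : measurableType d')
    (P' : probability S' R) (Y' : S' -> T) : Prop :=
  forall F : T -> R, continuous F -> bounded_fun F ->
    'E_(P n)[F \o Y n]%E @[n --> \oo] --> 'E_P'[F \o Y']%E.

(* [L t] is a density of [P t] with respect to the reference measure [mu]. *)
Definition is_likelihood (R : realType) d (X : measurableType d)
    (mu : {measure set X -> \bar R}) (Theta : set R)
    (P : R -> probability X R) (L : R -> X -> R) : Prop :=
  forall t, Theta t ->
    [/\ measurable_fun [set: X] (L t), forall x, 0 <= L t x &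
        forall A, measurable A -> P t A = (\int[mu]_(x in A) (L t x)%:E)%E].

(* [u] solves max (f (u-)) (f u) = sup_A f in [A]. *)
Definition is_argsup (R : realType) (A : set R) (f : R -> R) (u : R) : Prop :=
  A u /\ (Num.max (left_limit f u) (f u))%:E = ereal_sup [set (f t)%:E | t in A].

(* The end points may be infinite. *)
Definition param_set (R : realType) (alpha beta : \bar R) : set R :=
  [set t | (alpha < t%:E < beta)%E].

Definition local_bound (R : realType) (theta phi : R) (b : \bar R) : \bar R :=
  (phi^-1%:E * (b - theta%:E))%E.

(* [z] is the likelihood ratio normalized at [theta] with rate [phi], extended
   from (um, up) to the line; [l] is t |-> L(t, x) for the given observation
   x. The condition at [up] is void when [up] is infinite. *)
Definition extended_lr (R : realType) (alpha beta : \bar R) (theta phi : R)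
    (l : R -> R) (z : D0 R) : Prop :=
  let um := local_bound theta phi alpha in
  let up := local_bound theta phi beta in
  [/\ forall u, (um < u%:E < up)%E -> z u = l (theta + u * phi) / l theta,
      forall u, 0 <= z u,
      forall u v, (up <= u%:E)%E -> u <= v -> z v <= z u,
      forall u, u%:E = up -> z u <= left_limit z u &
      forall u v, (v%:E <= um)%E -> u <= v -> z u <= z v].

(* Main.v *)
(** The supremum over a completed graph of a Lipschitz function of the plane is
    an M1-continuous functional, since close parametric representations match
    the two graphs point by point.  For a bounded continuous [G >= 0], the
    functional
      [Phi_k f = sup {G w - k |u - w| - k (sup f - v) : (u, v) in graph f, w in R}]
    is therefore continuous and bounded; it dominates [G] at any argsup of [f],
    and tends to the value of [G] at the argsup as [k] grows when the argsup is
    unique and [sup f > 0].  Hence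
      [limsup E G(u_n) <= lim_n E Phi_k(Z_n) = E Phi_k(Z)] for all [k],
    and the right-hand side tends to [E G(eta)].  Positivity of [sup Z] holds
    because [Z_n 0 = 1] gives [sup Z_n >= 1], which passes to the weak limit. *)
Require Import Defs.
From HB Require Import structures.
From mathcomp Require Import all_boot all_order all_algebra.
From mathcomp Require Import all_classical all_reals all_analysis.
From mathcomp Require Import measurable_realfun ring lra.

Import Order.TTheory GRing.Theory Num.Theory.
Import numFieldNormedType.Exports.

Local Open Scope classical_set_scope.
Local Open Scope ring_scope.

(** * Bounds on completed graphs, and M1-continuity of suprema over them *)

Section D0_theory.
Context {R : realType}.
Implicit Types (f g : D0 R) (u b : R).

Lemma cvg_left_limit f u : f x @[x --> u^'-] --> left_limit f u.
Proof. by have [] := @D0_cadlag R f u Logic.I. Qed.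

Lemma left_limit_le f u b :
  (\forall x \near u^'-, f x <= b) -> left_limit f u <= b.
Proof. by move=> fb; apply: limr_le fb; exact: cvg_left_limit. Qed.

Lemma graph_max f u : graph f (u, Num.max (left_limit f u) (f u)).
Proof. by rewrite /graph /= lexx andbT ge_min le_max lexx. Qed.

Lemma graph_fun f u : graph f (u, f u).
Proof. by rewrite /graph /= ge_min le_max lexx !orbT. Qed.

Lemma graph_ubound f b p : (forall u, f u <= b) -> graph f p -> p.2 <= b.
Proof.
move=> fb /andP[_ /le_trans]; apply; rewrite ge_max fb andbT.
by apply: left_limit_le; near=> x.
Unshelve. all: by end_near. Qed.

(** Just right of [u] the values are close to [f u], just left of it to the left limit, so a strict
    bound on both persists nearby. *)
Lemma near_lt_of_max_lt f u b :
  Num.max (left_limit f u) (f u) < b -> \forall x \near u, f x < b.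
Proof.
rewrite gt_max => /andP[lb fb]; have [fr _] := @D0_cadlag R f u Logic.I.
have ll := cvg_left_limit f u.
have Hl : \forall x \near u^'-, f x < b by apply: (cvgr_lt _ ll).
have Hr : \forall x \near u^'+, f x < b by apply: (cvgr_lt _ fr).
move: Hl Hr; rewrite !near_withinE => Hl Hr; near=> x.
have [xu|ux|->//] := ltgtP x u.
- by move: xu; near: x.
- by move: ux; near: x.
Unshelve. all: by end_near. Qed.

Lemma D0_lt_outside f e : 0 < e -> exists N : R, forall u, N < `|u| -> f u < e.
Proof.
move=> e0.
have [a [_ Ha]] : \forall x \near +oo, f x < e.
  by apply: (cvgr_lt _ (@D0_cvgy R f)).
have [b [_ Hb]] : \forall x \near -oo, f x < e.
  by apply: (cvgr_lt _ (@D0_cvgNy R f)).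
exists (Num.max a (- b)) => u; rewrite gt_max => /andP[au bu].
have [u0|u0] := leP 0 u.
- by apply: Ha; move: au; rewrite ger0_norm.
- by apply: Hb; move: bu; rewrite ltr0_norm// ltrN2.
Qed.

Lemma D0_has_ubound f : exists C : R, forall u, f u <= C.
Proof.
have [N fN] := D0_lt_outside f 1 ltr01.
have /compact_near_coveringP cN := @segment_compact R (- N) N.
(* Compactness in near-covering form: local bounds valid for all large [c] become one bound on the
   whole segment. *)
have /= H := cN R (+oo) (fun c x => f x <= c) _.
have [A [_ HA]] : \forall c \near +oo, `[-N, N]%classic `<=` (fun x => f x <= c).
  apply: H => x _.
  set b := Num.max (left_limit f x) (f x) + 1.
  have fb : \forall x' \near x, f x' < b by apply: near_lt_of_max_lt; rewrite ltrDl.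
  exists ([set x' | f x' < b], [set c | b < c]) => /=.
    by split => //; exists b; split => //; exact: num_real.
  by move=> [y c] /= [h1 h2]; rewrite (le_trans (ltW h1))// ltW.
(* Nearness to infinity only speaks of [c > A], hence [A + 1]; the tails are bounded by 1. *)
exists (Num.max (A + 1) 1) => u; rewrite le_max.
have [uN|/fN/ltW ->] := leP `|u| N; last by rewrite orbT.
by rewrite (HA (A + 1))//= ?ltrDl// in_itv/= -ler_norml.
Qed.

(* Compactness makes the strict inequality uniform: as [f] vanishes at
   infinity, positivity of [b] confines the problem to a compact interval. *)
Lemma D0_gap f (eta delta b : R) : 0 < b ->
  (forall u, delta <= `|u - eta| -> Num.max (left_limit f u) (f u) < b) ->
  exists2 c, 0 < c & forall p, graph f p -> delta < `|p.1 - eta| -> p.2 <= b - c.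
Proof.
move=> b0 fb.
(* Outside [[-N, N]] any gap [c < b / 2] works, so only the segment remains. *)
have [N fN] := D0_lt_outside f (b / 2) (divr_gt0 b0 (ltr0Sn R 1)).
have /compact_near_coveringP cN := @segment_compact R (- N) N.
have /= H := cN R 0^'+ (fun c x => delta <= `|x - eta| -> f x <= b - c) _.
have H1 : \forall c \near 0^'+,
    `[-N, N]%classic `<=` (fun x => delta <= `|x - eta| -> f x <= b - c).
  apply: H => x _.
  (* If [x] is within [delta] of [eta], so are its neighbours, and the implication is vacuous
     there. *)
  have [dx|dx] := leP delta `|x - eta|; last first.
    have nx : \forall x' \near x, `|x' - eta| < delta.
      have : `|x' - eta| @[x' --> x] --> `|x - eta|.
        by apply: cvg_norm; apply: cvgB => //; exact: cvg_cst.
      by move=> h; apply: (cvgr_lt _ h).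
    exists ([set x' | `|x' - eta| < delta], setT) => /=.
      by split => //; exact: filterT.
    by move=> [y c] /= [h1 _]; rewrite leNgt h1.
  (* Near [x], [f] stays below the midpoint of [m] and [b], which leaves room for every
     [c < (b - m) / 2]. *)
  set m := Num.max (left_limit f x) (f x).
  have mb : m < b by exact: fb.
  have fm : \forall x' \near x, f x' < (m + b) / 2.
    by apply: near_lt_of_max_lt; rewrite -/m; lra.
  exists ([set x' | f x' < (m + b) / 2], [set c | c < (b - m) / 2]) => /=.
    by split => //; apply: nbhs_right_lt; lra.
  by move=> [y c] /= [h1 h2] _; lra.
have [c [[c0 cb] Hc]] : exists c, (0 < c /\ c < b / 2) /\
    `[-N, N]%classic `<=` (fun x => delta <= `|x - eta| -> f x <= b - c).
  near (0:R)^'+ => c; exists c; split; last by near: c.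
  split; near: c; [exact: nbhs_right_gt|apply: nbhs_right_lt; lra].
have Hf u : delta <= `|u - eta| -> f u <= b - c.
  move=> du; have [uN|/fN] := leP `|u| N; last by lra.
  by apply: Hc => //=; rewrite in_itv/= -ler_norml.
exists c => // -[u v] /= /andP[_ /= vm] du; apply: (le_trans vm).
rewrite ge_max; apply/andP; split; last by apply: Hf; exact: ltW.
apply: left_limit_le.
(* The strict inequality is an open condition, so the bound on values holds around [u] and passes to
   the left limit. *)
have : \forall x \near u, delta < `|x - eta|.
  have : `|x' - eta| @[x' --> u] --> `|u - eta|.
    by apply: cvg_norm; apply: cvgB => //; exact: cvg_cst.
  by move=> h; apply: (cvgr_gt _ h).
move=> /(@cvg_within _ (nbhs u)) => h; near=> x; apply/Hf/ltW; near: x; exact: h.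
Unshelve. all: by end_near. Qed.

(** Real-valued, so significant only when the image is bounded above; upper-bound hypotheses
    accompany its uses as a least upper bound. *)
Definition graph_sup (H : R * R -> R) f : R := sup (H @` graph f).

Lemma graph_sup_ub H f p : has_ubound (H @` graph f) -> graph f p ->
  H p <= graph_sup H f.
Proof. by move=> Hf fp; apply: ub_le_sup => //; exists p. Qed.

Lemma graph_sup_le H f b : (forall p, graph f p -> H p <= b) ->
  graph_sup H f <= b.
Proof.
move=> Hb; apply: ge_sup; first by exists (H (0, f 0)), (0, f 0) => //; exact: graph_fun.
by move=> _ [p /Hb ? <-].
Qed.

(** A common parameter matches every point of either graph with a nearby point of the other; this is
    the form in which M1-closeness is exploited. *)
Lemma dist_M1_near f g (e : R) : (dist_M1 f g < e%:E)%E ->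
  exists p q : R -> R * R, [/\ range p = graph f, range q = graph g &
    forall s, `|(p s).1 - (q s).1| + `|(p s).2 - (q s).2| < e].
Proof.
move=> /ereal_inf_lt[_ [t1 [y1 [t2 [y2 [[_ _ r1 _] [_ _ r2 _] ->]]]]] de].
exists (fun s => (t1 s, y1 s)), (fun s => (t2 s, y2 s)); split => //= s.
by rewrite -lte_fin; apply: le_lt_trans de; apply: ereal_sup_ubound; exists s.
Qed.

(** At matched points of two close graphs the values of [H] differ by at most [K] times the
    distance, hence so do the two suprema. *)
Lemma graph_sup_continuous (K : R) H : 0 < K ->
  (forall p q, `|H p - H q| <= K * (`|p.1 - q.1| + `|p.2 - q.2|)) ->
  (forall f, has_ubound (H @` graph f)) ->
  continuous (graph_sup H : D0 R -> R).
Proof.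
move=> K0 HK Hub; apply/continuousP => A oA.
(* Openness in [D0 R] is [M1_open] by construction. *)
suff : M1_open (graph_sup H @^-1` A) by [].
move=> f /= Af.
have [e /= e0 eA] : exists2 e : R, 0 < e & ball (graph_sup H f) e `<=` A.
  by apply/nbhs_ballP; move: oA; rewrite openE => /(_ _ Af).
(* This radius makes matched values differ by at most [e / 2], so that the suprema differ by
   strictly less than [e]. *)
exists (e / 2 / K); first by rewrite !divr_gt0.
move=> g /dist_M1_near[p [q [rp rq pq]]]; apply: eA.
have fp s : graph f (p s) by rewrite -rp; exists s.
have gq s : graph g (q s) by rewrite -rq; exists s.
have Hpq s : `|H (p s) - H (q s)| <= e / 2.
  rewrite (le_trans (HK _ _))//.
  by have := ltW (pq s); rewrite ler_pdivlMr// mulrC.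
rewrite /ball /= (@le_lt_trans _ _ (e / 2))//; last by lra.
rewrite ler_distl; apply/andP; split.
- rewrite lerBlDr; apply: graph_sup_le => z; rewrite -rq => -[s _ <-].
  have := Hpq s; rewrite distrC ler_distl => /andP[_ /le_trans]; apply.
  by rewrite lerD2r; exact: graph_sup_ub.
- apply: graph_sup_le => z; rewrite -rp => -[s _ <-].
  have := Hpq s; rewrite ler_distl => /andP[_ /le_trans]; apply.
  by rewrite lerD2r; exact: graph_sup_ub.
Qed.

End D0_theory.

Lemma continuous_subM (R : realType) (T : topologicalType) (F H : T -> R) k :
  continuous F -> continuous H -> continuous (fun x => F x - k * H x).
Proof.
move=> cF cH x; apply: cvgB; first exact: cF.
by apply: cvgM; [exact: cvg_cst|exact: cH].
Qed.

(** * The penalized functional and its limit at a unique argsup *)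

Section argsup_functional.
Context {R : realType}.
Implicit Types (f g : D0 R) (u b k C : R) (G : R -> R).

(** Taken over the completed graph, not over the values, so that [graph_sup_continuous] applies to
    it. *)
Definition height f : R := graph_sup snd f.

Lemma height_has_ubound f : has_ubound (snd @` graph f).
Proof.
have [C fC] := D0_has_ubound f; exists C => _ [p fp <-].
exact: graph_ubound fp.
Qed.

Lemma height_ub f p : graph f p -> p.2 <= height f.
Proof. by apply: graph_sup_ub; exact: height_has_ubound. Qed.

(** Left limits never exceed the supremum of the values, so filling in the jumps does not raise
    it. *)
Lemma heightE f : ereal_sup [set (f t)%:E | t in [set: R]] = (height f)%:E.
Proof.
have fb : has_ubound (range f).
  by have [C fC] := D0_has_ubound f; exists C => _ [u _ <-].
rewrite -(image_comp f EFin) ereal_sup_EFin//; last by exists (f 0), 0.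
congr EFin; apply/eqP; rewrite eq_le; apply/andP; split.
- apply: ge_sup; first by exists (f 0), 0.
  by move=> _ [u _ <-]; apply: (@height_ub f (u, f u)); exact: graph_fun.
- apply: graph_sup_le => p; apply: graph_ubound => u.
  by apply: ub_le_sup => //; exists u.
Qed.

Lemma is_argsup_height f u :
  is_argsup [set: R] f u <-> Num.max (left_limit f u) (f u) = height f.
Proof.
rewrite /is_argsup heightE; split => [[_ []//]|->]; by split.
Qed.

Lemma height_continuous : continuous (height : D0 R -> R).
Proof.
apply: (@graph_sup_continuous R 1) => // [p q|]; last exact: height_has_ubound.
by rewrite mul1r lerDr.
Qed.

(** Sup-convolution of [G] with [k |.|]: for [G] bounded above and [k > 0], its least [k]-Lipschitz
    majorant. *)
Definition lipschitz_envelope G k u : R :=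
  sup (range (fun w => G w - k * `|u - w|)).

Lemma lipschitz_envelope_le G k u b : (forall w, G w - k * `|u - w| <= b) ->
  lipschitz_envelope G k u <= b.
Proof.
move=> Gb; apply: ge_sup => [|_ [w _ <-]//].
by exists (G 0 - k * `|u - 0|), 0.
Qed.

Section bounded.
Variables (G : R -> R) (C k : R).
Hypotheses (G0 : forall w, 0 <= G w) (GC : forall w, G w <= C) (k0 : 0 < k).

Let penalty_ge0 u w : 0 <= k * `|u - w|.
Proof. by rewrite mulr_ge0// ltW. Qed.

Lemma lipschitz_envelope_ub u w :
  G w - k * `|u - w| <= lipschitz_envelope G k u.
Proof.
apply: ub_le_sup; last by exists w.
by exists C => _ [v _ <-]; have := penalty_ge0 u v; have := GC v; lra.
Qed.

Lemma le_lipschitz_envelope u : G u <= lipschitz_envelope G k u.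
Proof. by have := lipschitz_envelope_ub u u; rewrite subrr normr0 mulr0 subr0. Qed.

(** For each fixed [w], the penalties paid from two points differ by at most [k] times the distance
    of these points. *)
Lemma lipschitz_envelope_lipschitz u v :
  `|lipschitz_envelope G k u - lipschitz_envelope G k v| <= k * `|u - v|.
Proof.
have H x y : lipschitz_envelope G k x <= lipschitz_envelope G k y + k * `|x - y|.
  apply: lipschitz_envelope_le => w; have := lipschitz_envelope_ub y w.
  have : k * `|y - w| <= k * (`|x - y| + `|x - w|).
    by rewrite ler_pM2l// (distrC x y) (le_trans _ (ler_normD _ _))// subrKA.
  by rewrite mulrDr; lra.
by rewrite ler_distl; have := H u v; have := H v u; rewrite (distrC v u); lra.
Qed.

(* An upper semicontinuous relaxation, continuous for M1, of the value of [G]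
   at the argsup: a point of the completed graph pays for its distance to the
   maximal height, and [G] is replaced by its Lipschitz envelope because the
   abscissas of the graph are not confined to a compact set. *)
Definition argsup_relax G k f : R :=
  graph_sup (fun p => lipschitz_envelope G k p.1 + k * p.2) f - k * height f.

Let relax_has_ubound f :
  has_ubound ((fun p => lipschitz_envelope G k p.1 + k * p.2) @` graph f).
Proof.
exists (C + k * height f) => _ [p fp <-]; apply: lerD.
  by apply: lipschitz_envelope_le => w; have := GC w; have := penalty_ge0 p.1 w; lra.
by rewrite ler_pM2l//; exact: height_ub.
Qed.

Lemma argsup_relax_continuous : continuous (argsup_relax G k : D0 R -> R).
Proof.
apply: continuous_subM; last exact: height_continuous.
apply: (@graph_sup_continuous R k) => // p q.
rewrite mulrDr.
rewrite [X in `|X|](_ : _ = (lipschitz_envelope G k p.1 - lipschitz_envelope G k q.1) +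
   k * (p.2 - q.2)); last by ring.
rewrite (le_trans (ler_normD _ _))// lerD ?lipschitz_envelope_lipschitz//.
by rewrite normrM gtr0_norm.
Qed.

Lemma argsup_relax_ge0 f : 0 <= argsup_relax G k f.
Proof.
rewrite subr_ge0 mulrC -ler_pdivlMr//; apply: graph_sup_le => p fp.
rewrite ler_pdivlMr// mulrC; apply: le_trans (graph_sup_ub _ f p _ fp) => //.
by rewrite lerDr (le_trans (G0 p.1))// le_lipschitz_envelope.
Qed.

(** Opens both suprema at once, over the graph and inside the envelope, leaving an inequality for
    each pair [(p, w)]. *)
Lemma argsup_relax_le f b :
  (forall p w, graph f p -> G w - k * `|p.1 - w| + k * p.2 <= b + k * height f) ->
  argsup_relax G k f <= b.
Proof.
move=> Hb; rewrite lerBlDr; apply: graph_sup_le => p fp.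
rewrite -lerBrDr; apply: lipschitz_envelope_le => w.
by rewrite lerBrDr Hb.
Qed.

Lemma argsup_relax_le_bound f : argsup_relax G k f <= C.
Proof.
apply: argsup_relax_le => p w fp; have := GC w; have := penalty_ge0 p.1 w.
by have := height_ub f p fp; rewrite -(ler_pM2l k0); lra.
Qed.

(** The top of the graph above an argsup has maximal height, so it pays no penalty. *)
Lemma le_argsup_relax f u : is_argsup [set: R] f u -> G u <= argsup_relax G k f.
Proof.
move=> /is_argsup_height fu; rewrite lerBrDr.
apply: le_trans (graph_sup_ub _ f _ _ (graph_max f u)) => //=.
by rewrite fu lerD2r le_lipschitz_envelope.
Qed.

End bounded.

(** For a large penalty, a graph point far from [eta] loses at least [C] in height, and a [w] far
    from its graph point loses at least [C] in distance; the remaining [w] are close to [eta], where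
    continuity of [G] decides. *)
Lemma argsup_relax_cvg G C f eta :
  (forall w, 0 <= G w) -> (forall w, G w <= C) -> {for eta, continuous G} ->
  0 < height f -> unique (is_argsup [set: R] f) eta ->
  argsup_relax G n.+1%:R f @[n --> \oo] --> G eta.
Proof.
move=> G0 GC cG f0 [aeta ueta].
apply/cvgrPdist_le => e e0.
(* One [d] is for the distance from [eta] to the graph point, the other for that from the graph
   point to [w]. *)
have [d /= d0 dG] : exists2 d : R, 0 < d & forall w, `|w - eta| < d + d -> G w <= G eta + e.
  have /cvgrPdist_le/(_ _ e0) := cG.
  move=> /nbhs_ballP[d /= d0 dG]; exists (d / 2) => [|w]; first exact: divr_gt0.
  rewrite -splitr => wd; have := dG w; rewrite /ball/= distrC => /(_ wd).
  by rewrite distrC ler_distl => /andP[].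
have fM u : Num.max (left_limit f u) (f u) <= height f.
  by apply: (height_ub f (u, _)); exact: graph_max.
have [c c0 cf] : exists2 c, 0 < c &
    forall p, graph f p -> d < `|p.1 - eta| -> p.2 <= height f - c.
  (* Uniqueness enters here: reaching the height at distance [d] or more would give a second
     argsup. *)
  apply: D0_gap => // u du; rewrite lt_neqAle fM andbT.
  apply/eqP => /is_argsup_height/ueta eu; move: du.
  by rewrite -eu subrr normr0 leNgt d0.
near=> n.
have n0 : 0 < n.+1%:R :> R by [].
have nn : n%:R <= n.+1%:R :> R by rewrite ler_nat.
have nd : C <= n.+1%:R * d.
  rewrite -ler_pdivrMr// (le_trans _ nn)//; near: n; exact: nbhs_infty_ger.
have nc : C <= n.+1%:R * c.
  rewrite -ler_pdivrMr// (le_trans _ nn)//; near: n; exact: nbhs_infty_ger.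
(* Only the upper estimate is left, as the relaxation dominates [G eta]. *)
rewrite distrC ger0_norm ?subr_ge0; last exact: (le_argsup_relax G C).
rewrite lerBlDl; apply: argsup_relax_le => p w fp.
set k := n.+1%:R in n0 nd nc *.
have kw : 0 <= k * `|p.1 - w| by rewrite mulr_ge0// ltW.
have kv : k * p.2 <= k * height f by rewrite ler_pM2l//; exact: height_ub.
have := GC w; have := G0 eta.
have [/(cf p fp) pc|pd] := ltP d `|p.1 - eta|.
  by move: pc; rewrite -(ler_pM2l n0) mulrBr; lra.
have [wd|wd] := leP d `|p.1 - w|.
  by move: wd; rewrite -(ler_pM2l n0); lra.
have : G w <= G eta + e.
  apply: dG; rewrite -(subrKA p.1) (le_lt_trans (ler_normD _ _))//.
  by rewrite distrC ltr_leD.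
lra.
Unshelve. all: by end_near. Qed.

End argsup_functional.

(** * From the argsup of the likelihood to that of the normalized ratio *)

Section normalized_argsup.
Context {R : realType}.
Variables (theta phi : R).
Hypothesis phi0 : 0 < phi.

Lemma lt_local_bound (x : R) (b : \bar R) :
  (x%:E < local_bound theta phi b)%E = ((theta + x * phi)%:E < b)%E.
Proof.
rewrite /local_bound; case: b => [b| |].
- by rewrite -EFinB -EFinM !lte_fin -ltrBrDl ltr_pdivlMl// mulrC.
- by rewrite addye// gt0_muley ?lte_fin ?invr_gt0// !ltry.
- by rewrite addNye gt0_muleNy ?lte_fin ?invr_gt0// !ltNge !leNye.
Qed.

Lemma gt_local_bound (x : R) (b : \bar R) :
  (local_bound theta phi b < x%:E)%E = (b < (theta + x * phi)%:E)%E.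
Proof.
rewrite /local_bound; case: b => [b| |].
- by rewrite -EFinB -EFinM !lte_fin -ltrBlDl ltr_pdivrMl// mulrC.
- by rewrite addye// gt0_muley ?lte_fin ?invr_gt0// !ltNge !leey.
- by rewrite addNye gt0_muleNy ?lte_fin ?invr_gt0// !ltNyr.
Qed.

(** The slope [phi] is positive, so the left side is preserved and left limits can be
    transported. *)
Lemma cvg_at_left_affine (u : R) :
  theta + x * phi @[x --> u^'-] --> (theta + u * phi)^'-.
Proof.
have c : theta + x * phi @[x --> u^'-] --> theta + u * phi.
  apply: cvg_at_left_filter; apply: cvgD; first exact: cvg_cst.
  by apply: cvgM => //; exact: cvg_cst.
move=> A; rewrite /nbhs/= /within/= => /c; rewrite /nbhs/= => h.
near=> x; have := near h x; apply => //.
by rewrite ltrD2l ltr_pM2r//; near: x; exact: nbhs_left_lt.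
Unshelve. all: by end_near. Qed.

(** Inside the window [z] is [l] rescaled by a positive constant after an increasing affine change
    of variable; outside it, the monotone extension creates no larger value. *)
Lemma extended_lr_argsup (alpha beta : \bar R) (l : R -> R) (z : D0 R) (t : R) :
  param_set alpha beta theta -> cadlag_on (param_set alpha beta) l ->
  (forall s, param_set alpha beta s -> 0 <= l s) -> l theta != 0 ->
  extended_lr alpha beta theta phi l z ->
  is_argsup (param_set alpha beta) l t ->
  is_argsup [set: R] z (phi^-1 * (t - theta)).
Proof.
move=> Ttheta lcad l0 lth [zE z0 zup zupl zum] [Tt tsup].
have lt0 : 0 < l theta by rewrite lt_neqAle eq_sym lth l0.
have UE (x : R) : (local_bound theta phi alpha < x%:E < local_bound theta phi beta)%E =
    (alpha < (theta + x * phi)%:E < beta)%E.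
  by rewrite lt_local_bound gt_local_bound.
set S := Num.max (left_limit l t) (l t) in tsup.
have lS s : param_set alpha beta s -> l s <= S.
  by move=> Ts; rewrite -lee_fin tsup; apply: ereal_sup_ubound; exists s.
have zU (x : R) : (local_bound theta phi alpha < x%:E < local_bound theta phi beta)%E ->
    z x <= S / l theta.
  by move=> Ux; rewrite zE// ler_pM2r ?invr_gt0// lS// /param_set/= -UE.
(* The window contains 0, so the inner side of a finite end point lies in it. *)
have lb0 : (local_bound theta phi alpha < 0%:E < local_bound theta phi beta)%E.
  by rewrite UE mul0r addr0.
have zS x : z x <= S / l theta.
  (* To the right, [z x] is at most the value at the end point, which is at most the left limit
     there, a limit of values in the window. *)
  have [xup|xup] := leP (local_bound theta phi beta) x%:E.
    case E : (local_bound theta phi beta) xup lb0 => [b| |]//=; last first.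
      by rewrite ltNge leNye andbF.
    rewrite lee_fin => bx /andP[a0 b0].
    rewrite (le_trans (zup b x _ bx)) ?E//.
    rewrite (le_trans (zupl b _)) ?E//; apply: left_limit_le.
    near=> y; apply: zU; rewrite E lte_fin; apply/andP; split.
      rewrite (lt_trans a0)// lte_fin; near: y; apply: nbhs_left_gt.
      by move: b0; rewrite lte_fin.
    by near: y; exact: nbhs_left_lt.
  have [xum|xum] := leP x%:E (local_bound theta phi alpha); last first.
    by apply: zU; rewrite xum xup.
  (* To the left, right-continuity at the end point gives the bound. *)
  case E : (local_bound theta phi alpha) xum lb0 => [a| |]//=.
    rewrite lee_fin => xa /andP[a0 b0].
    rewrite (le_trans (zum x a _ xa)) ?E//.
    have [za _] := @D0_cadlag R z a Logic.I.
    apply: (@cvgr_to_le _ _ _ _ _ _ _ za) => //.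
    near=> y; apply: zU; rewrite E lte_fin; apply/andP; split.
      by near: y; exact: nbhs_right_gt.
    rewrite (le_lt_trans _ b0)// lee_fin; near: y; apply: nbhs_right_le.
    by move: a0; rewrite lte_fin.
set u := phi^-1 * (t - theta).
have tE : theta + u * phi = t by rewrite /u mulrAC mulVf ?gt_eqF// mul1r addrC subrK.
have Uu : (local_bound theta phi alpha < u%:E < local_bound theta phi beta)%E by rewrite UE tE.
have zuE : z u = l t / l theta by rewrite zE// tE.
(* Points just left of [u] are still in the open window, where [z] is the rescaled [l]. *)
have zlE : left_limit z u = left_limit l t / l theta.
  have [_ ll] := lcad t Tt.
  apply: cvg_lim => //.
  have : l (theta + x * phi) / l theta @[x --> u^'-] --> left_limit l t / l theta.
    apply: cvgM; last exact: cvg_cst.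
    apply: (@cvg_comp _ _ _ (fun x => theta + x * phi) l _ (t^'-)) ll.
    by have := @cvg_at_left_affine u; rewrite tE.
  have nu : \forall x \near u^'-, (local_bound theta phi alpha < x%:E)%E.
    move: Uu => /andP[au _].
    case E : (local_bound theta phi alpha) au => [a| |]//; last first.
      by move=> _; near=> x; rewrite ltNyr.
    by rewrite lte_fin => au; near=> x; rewrite lte_fin; near: x; exact: nbhs_left_gt.
  apply: cvg_trans; apply: near_eq_cvg.
  near=> x; rewrite zE// UE.
  have [at_ tb] := andP Tt.
  have xu : x < u by near: x; exact: nbhs_left_lt.
  apply/andP; split; last first.
    apply: lt_trans tb; rewrite lte_fin -[in ltRHS]tE ltrD2l ltr_pM2r//.
  by rewrite -gt_local_bound; near: x.
apply/is_argsup_height; apply/eqP; rewrite eq_le; apply/andP; split.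
  by apply: (height_ub z (u, _)); exact: graph_max.
rewrite (_ : Num.max _ _ = S / l theta).
  by apply: graph_sup_le => p; exact: graph_ubound.
by rewrite zlE zuE /S maxr_pMl// invr_ge0 ltW.
Unshelve. all: by end_near. Qed.

End normalized_argsup.

(** * Measurability, bounded expectations and almost sure statements *)

Lemma random_element_measurable_comp (R : realType) d (S : measurableType d)
    (T : topologicalType) (Y : S -> T) (F : T -> R) :
  random_element Y -> continuous F -> measurable_fun [set: S] (F \o Y).
Proof.
move=> mY /continuousP cF; apply: (measurability _ (RGenOpens.measurableE R)).
move=> _ [_ [a [b ->] <-]]; rewrite setTI comp_preimage; apply: mY.
by apply: sub_sigma_algebra; apply/cF/interval_open.
Qed.

Section bounded_expectation.
Context {R : realType} {d : measure_display} {S : measurableType d}.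
Variables (P : probability S R) (X : S -> R) (C : R).
Hypotheses (mX : measurable_fun [set: S] X) (XC : forall x, `|X x| <= C).

Lemma bounded_Lfun1 : X \in Lfun P 1.
Proof.
apply/Lfun1_integrable; apply: measurable_bounded_integrable => //.
  by rewrite (le_lt_trans (probability_le1 P measurableT))// ltry.
by exists C; split => [|M CM x _]; [exact: num_real|exact: le_trans (XC x) (ltW CM)].
Qed.

Lemma bounded_expectation_fin_num : 'E_P[X]%E \is a fin_num.
Proof. exact/expectation_fin_num/bounded_Lfun1. Qed.

Lemma expectation_addl (c : R) : 'E_P[fun x => (c + X x)%R]%E = (c%:E + 'E_P[X])%E.
Proof.
by rewrite -(expectation_cst P c) -expectationD ?bounded_Lfun1 ?Lfun_cst.
Qed.

Lemma expectation_subl (c : R) : 'E_P[fun x => (c - X x)%R]%E = (c%:E - 'E_P[X])%E.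
Proof.
by rewrite -[in RHS](expectation_cst P c) -expectationB ?bounded_Lfun1 ?Lfun_cst.
Qed.

End bounded_expectation.

(* Applied to [C + F] and [C - F], a one-sided estimate for nonnegative test
   functions gives both halves of the convergence. *)
Lemma weak_cvg_of_limsup (R : realType)
    (d : nat -> measure_display) (S : forall n, measurableType (d n))
    (P : forall n, probability (S n) R) (Y : forall n, S n -> R)
    (d' : measure_display) (S' : measurableType d')
    (P' : probability S' R) (Y' : S' -> R) :
  (forall n, measurable_fun [set: S n] (Y n)) -> measurable_fun [set: S'] Y' ->
  (forall (G : R -> R) C, continuous G -> (forall w, 0 <= G w) ->
    (forall w, G w <= C) -> forall e : R, 0 < e ->
    \forall n \near \oo, ('E_(P n)[G \o Y n] <= 'E_P'[G \o Y'] + e%:E)%E) ->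
  weak_cvg P Y P' Y'.
Proof.
move=> mY mY' limsup F cF [M [_ FM]].
(* [bounded_fun] provides the bound only for constants strictly above [M]. *)
have {FM} : forall x, `|F x| <= M + 1 by move=> x; apply: FM => //; rewrite ltrDl.
set C := M + 1 => FC.
have mF : measurable_fun [set: R] F by exact: continuous_measurable_fun.
have mFY n : measurable_fun [set: S n] (F \o Y n) by exact: measurableT_comp.
have mFY' : measurable_fun [set: S'] (F \o Y') by exact: measurableT_comp.
have fn n : ('E_(P n)[F \o Y n])%E \is a fin_num.
  by apply: (@bounded_expectation_fin_num _ _ _ _ _ C) => // x; exact: FC.
have f' : ('E_P'[F \o Y'])%E \is a fin_num.
  by apply: (@bounded_expectation_fin_num _ _ _ _ _ C) => // x; exact: FC.
rewrite -(fineK f'); apply/fine_cvgP; split; first exact: nearW.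
apply/cvgrPdist_le => e e0.
have Up : \forall n \near \oo,
    ('E_(P n)[fun x => (C + F (Y n x))%R] <= 'E_P'[fun x => (C + F (Y' x))%R] + e%:E)%E.
  apply: (limsup (fun x => C + F x) (C + C)) => // [x|w|w].
  - by apply: cvgD; [exact: cvg_cst|exact: cF].
  - by have := FC w; rewrite ler_norml; lra.
  - by have := FC w; rewrite ler_norml; lra.
have Lo : \forall n \near \oo,
    ('E_(P n)[fun x => (C - F (Y n x))%R] <= 'E_P'[fun x => (C - F (Y' x))%R] + e%:E)%E.
  apply: (limsup (fun x => C - F x) (C + C)) => // [x|w|w].
  - by apply: cvgB; [exact: cvg_cst|exact: cF].
  - by have := FC w; rewrite ler_norml; lra.
  - by have := FC w; rewrite ler_norml; lra.
have subE n := @expectation_subl _ _ _ (P n) (F \o Y n) C (mFY n) (fun x => FC _) C.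
have addE n := @expectation_addl _ _ _ (P n) (F \o Y n) C (mFY n) (fun x => FC _) C.
have subE' := @expectation_subl _ _ _ P' (F \o Y') C mFY' (fun x => FC _) C.
have addE' := @expectation_addl _ _ _ P' (F \o Y') C mFY' (fun x => FC _) C.
apply: filterS2 Up Lo => n.
rewrite subE addE subE' addE' -(fineK (fn n)) -(fineK f').
rewrite -!EFinN -!EFinD !lee_fin => up lo.
rewrite ler_distl/=; apply/andP; split; lra.
Qed.

Lemma ae_eq0_of_expectation (R : realType) d (S : measurableType d)
    (P : probability S R) (X : S -> R) :
  measurable_fun [set: S] X -> (forall x, 0 <= X x) -> 'E_P[X]%E = 0%E ->
  {ae P, forall x, X x = 0}.
Proof.
move=> mX X0; rewrite unlock => EX.
have mE : measurable_fun [set: S] (EFin \o X) by exact/measurable_EFinP.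
have /(ae_eq_integral_abs P measurableT mE) : (\int[P]_x `|(EFin \o X) x| = 0)%E.
  by rewrite -[RHS]EX; apply: eq_integral => x _ /=; rewrite ger0_norm.
by apply: filterS => x /(_ Logic.I) [].
Qed.

(** The probability of the zero set of a density is the integral of the density over that set. *)
Lemma likelihood_neq0 (R : realType) d (X : measurableType d)
    (mu : {measure set X -> \bar R}) (Theta : set R)
    (P : R -> probability X R) (L : R -> X -> R) t :
  is_likelihood mu Theta P L -> Theta t -> {ae P t, forall x, L t x != 0}.
Proof.
move=> /[apply] -[mL L0 PL].
have m0 : measurable (L t @^-1` [set 0]) by rewrite -[X in measurable X]setTI; exact: mL.
exists (L t @^-1` [set 0]); split => //.
  by rewrite PL// integral0_eq// => x ->.
by move=> x /= /negP; rewrite negbK => /eqP.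
Qed.

(** * Passage to the limit in distribution *)

Section argsup_convergence.
Context {R : realType} {d : nat -> measure_display}
  {S : forall n, measurableType (d n)} {d' : measure_display}
  {S' : measurableType d'}.
Variables (P : forall n, probability (S n) R) (Q : probability S' R).
Variables (Zn : forall n, S n -> D0 R) (Z : S' -> D0 R).
Hypotheses (Zn_meas : forall n, random_element (Zn n)) (Z_meas : random_element Z).
Hypothesis Zn_cvg : weak_cvg P Zn Q Z.

Lemma weak_limit_height_ge (c : R) :
  (forall n, {ae P n, forall x, c <= height (Zn n x)}) ->
  {ae Q, forall w, c <= height (Z w)}.
Proof.
move=> Znc.
(* A bounded M1-continuous test functional that vanishes exactly when the height is at least [c];
   its null expectations pass to the limit. *)
pose psi (f : D0 R) := Num.min 1 (Num.max 0 (c - height f)).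
have psi0 f : 0 <= psi f by rewrite /psi le_min ler01/= le_max lexx.
have cpsi : continuous psi.
  move=> f; apply: (@continuous_comp _ _ _ (height : D0 R -> R)
    (fun h => Num.min 1 (Num.max 0 (c - h)))); first exact: height_continuous.
  apply: continuous_min; first exact: cst_continuous.
  apply: continuous_max; first exact: cst_continuous.
  by apply: cvgB => //; exact: cvg_cst.
have bpsi : bounded_fun psi.
  exists 1; split => [|M M1 f _]; first exact: num_real.
  suff : `|psi f| <= M by [].
  by rewrite ger0_norm//; apply: le_trans (ltW M1); rewrite /psi ge_min lexx.
have mpsi : measurable_fun [set: S'] (psi \o Z).
  exact: random_element_measurable_comp.
have E0 n : ('E_(P n)[psi \o Zn n])%E = 0%E.
  apply/eqP; rewrite eq_le expectation_ge0 ?andbT => [|x]; last exact: psi0.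
  rewrite -[leRHS](expectation_cst (P n) 0); apply: expectation_le => //.
  - exact: random_element_measurable_comp.
  - by move=> x; exact: psi0.
  - have := Znc n; apply: filterS => x /=; rewrite -subr_le0 => ch.
    by rewrite /psi (max_idPl ch) ge_min lexx orbT.
have : {ae Q, forall w, (psi \o Z) w = 0}.
  apply: ae_eq0_of_expectation => // [w|]; first exact: psi0.
  have := Zn_cvg psi cpsi bpsi; under eq_cvg do rewrite E0.
  by move=> h; apply/esym; apply: (cvg_unique _ _ h) => //; exact: cvg_cst.
apply: filterS => w /= h; rewrite leNgt; apply/negP => hc; move: h.
move/eqP; rewrite gt_eqF// /psi lt_min ltr01/= lt_max subr_gt0 hc orbT//.
Qed.

(** The penalty is fixed from the limit law alone; weak convergence is then applied to that single
    functional. *)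
Lemma argsup_weak_cvg (un : forall n, S n -> R) (eta : S' -> R) (c : R) :
  0 < c ->
  (forall n, measurable_fun [set: S n] (un n)) -> measurable_fun [set: S'] eta ->
  (forall n, {ae P n, forall x, c <= height (Zn n x)}) ->
  (forall n, {ae P n, forall x, is_argsup [set: R] (Zn n x) (un n x)}) ->
  {ae Q, forall w, unique (is_argsup [set: R] (Z w)) (eta w)} ->
  weak_cvg P un Q eta.
Proof.
move=> c0 mun meta Znc aun aeta; apply: weak_cvg_of_limsup => //.
move=> G C cG G0 GC e e0.
have mG : measurable_fun [set: R] G by exact: continuous_measurable_fun.
(* The successor keeps the penalty positive. *)
pose F k : D0 R -> R := argsup_relax G k.+1%:R.
have cF k : continuous (F k) by exact: (argsup_relax_continuous G C).
have F0 k f : 0 <= F k f by exact: (argsup_relax_ge0 G C).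
have FC k f : F k f <= C by exact: argsup_relax_le_bound.
have bF k : bounded_fun (F k).
  exists C; split => [|M CM f _]; first exact: num_real.
  suff : `|F k f| <= M by [].
  by rewrite ger0_norm//; exact: le_trans (FC k f) (ltW CM).
have mFn k n : measurable_fun [set: S n] (F k \o Zn n).
  exact: random_element_measurable_comp.
have mFZ k : measurable_fun [set: S'] (F k \o Z).
  exact: random_element_measurable_comp.
have mGe : measurable_fun [set: S'] (G \o eta) by exact: measurableT_comp.
have fG : ('E_Q[G \o eta])%E \is a fin_num.
  by apply: (@bounded_expectation_fin_num _ _ _ _ _ C) => // x; rewrite /= ger0_norm.
have fF k : ('E_Q[F k \o Z])%E \is a fin_num.
  by apply: (@bounded_expectation_fin_num _ _ _ _ _ C) => // x; rewrite /= ger0_norm.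
have le_F k n : ('E_(P n)[G \o un n] <= 'E_(P n)[F k \o Zn n])%E.
  apply: expectation_le => //.
  - exact: measurableT_comp.
  - by move=> x; exact: G0.
  - by move=> x; exact: F0.
  - have := aun n; apply: filterS => x /= ux; exact: (le_argsup_relax G C).
have cvgF : 'E_Q[F k \o Z]%E @[k --> \oo] --> 'E_Q[G \o eta]%E.
  rewrite unlock.
  have [|||||_ _] := @dominated_convergence _ _ _ Q setT measurableT
    (fun k w => ((F k \o Z) w)%:E) (fun w => ((G \o eta) w)%:E) (cst C%:E); last by [].
  - by move=> k; exact/measurable_EFinP.
  - exact/measurable_EFinP.
  (* Almost surely the limit has height at least [c > 0], as the pointwise convergence requires. *)
  - have hZ := weak_limit_height_ge c Znc.
    apply: filterS2 hZ aeta => w hw uw _.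
    apply: cvg_EFin; first exact: nearW.
    by apply: (argsup_relax_cvg G C) => //; [exact: cG|exact: lt_le_trans c0 hw].
  - exact: finite_measure_integrable_cst.
  - by apply: aeW => w k _; rewrite /= lee_fin ger0_norm.
(* Half of [e] is spent on the choice of [k], the other half on weak convergence for this [k]. *)
have [k Fk] : exists k, ('E_Q[F k \o Z] <= 'E_Q[G \o eta] + (e / 2)%:E)%E.
  move: cvgF; rewrite -(fineK fG) => /fine_cvgP[_ /cvgrPdist_le/(_ (e / 2))].
  case=> [|k _ /(_ k (leqnn k))]; first by rewrite divr_gt0.
  rewrite ler_distlC /= => /andP[_ Fk]; exists k.
  by rewrite -(fineK (fF k)) -EFinD lee_fin.
have := Zn_cvg _ (cF k) (bF k); rewrite -(fineK (fF k)).
move=> /fine_cvgP[Fn /cvgrPdist_le/(_ (e / 2))].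
have /[swap]/[apply] Fd : 0 < e / 2 by rewrite divr_gt0.
apply: filterS2 Fn Fd => n fn; rewrite ler_distlC /= => /andP[_ d2].
apply: (le_trans (le_F k n)); move: Fk d2.
rewrite -(fineK fn) -(fineK (fF k)) -(fineK fG) -!EFinD !lee_fin; lra.
Qed.

End argsup_convergence.

Theorem mainTheorem2 (R : realType)
  (alpha beta : \bar R)
  (d : nat -> measure_display) (X : forall n, measurableType (d n))
  (P : forall n, R -> probability (X n) R)
  (mu : forall n, {measure set (X n) -> \bar R})
  (L : forall n, R -> X n -> R)
  (hL : forall n, is_likelihood (mu n) (param_set alpha beta) (P n) (L n))
  (Lcadlag : forall n (x : X n),
     cadlag_on (param_set alpha beta) (fun t => L n t x))
  (thetahat : forall n, X n -> R)
  (thetahat_meas : forall n, measurable_fun [set: X n] (thetahat n))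
  (thetahat_mle : forall n (x : X n),
     is_argsup (param_set alpha beta) (fun t => L n t x) (thetahat n x))
  (theta : R) (htheta : param_set alpha beta theta)
  (phi : nat -> R) (phi_gt0 : forall n, 0 < phi n)
  (phi_decr : nonincreasing_seq phi)
  (phi_cvg : phi n @[n --> \oo] --> (0 : R))
  (Zn : forall n, X n -> D0 R)
  (Zn_meas : forall n, random_element (Zn n))
  (* the ratio is undefined where L(theta, x) = 0, a P_theta-null event *)
  (ZnE : forall n (x : X n), L n theta x != 0 ->
     extended_lr alpha beta theta (phi n) (fun t => L n t x) (Zn n x))
  (d' : measure_display) (Omega : measurableType d')
  (Q : probability Omega R)
  (Z : Omega -> D0 R) (Z_meas : random_element Z)
  (Zn_cvg : weak_cvg (fun n => P n theta) Zn Q Z)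
  (eta : Omega -> R) (eta_meas : measurable_fun [set: Omega] eta)
  (eta_argsup : {ae Q, forall w, unique (is_argsup [set: R] (Z w)) (eta w)}) :
  weak_cvg (fun n => P n theta)
    (fun n x => (phi n)^-1 * (thetahat n x - theta)) Q eta.
Proof.
have Lneq0 n := likelihood_neq0 _ _ _ _ _ _ _ _ (hL n) htheta.
(* The lower bound for the heights is 1, the value of the likelihood ratio at 0. *)
apply: (argsup_weak_cvg _ _ _ _ Zn_meas Z_meas Zn_cvg _ _ _ ltr01) => // n.
- by apply: measurable_funM => //; apply: measurable_funB.
- have := Lneq0 n; apply: filterS => x Lx; have [zE _ _ _ _] := ZnE n x Lx.
  have <- : Zn n x 0 = 1.
    by rewrite zE ?mul0r ?addr0 ?divff// lt_local_bound// gt_local_bound// mul0r addr0.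
  by apply: (height_ub _ (0, _)); exact: graph_fun.
- have := Lneq0 n; apply: filterS => x Lx.
  apply: (extended_lr_argsup _ _ (phi_gt0 n) _ _ _ _ _ htheta
    (Lcadlag n x) _ Lx (ZnE n x Lx)) => //.
  by move=> s Ts; have [_ ->] := hL n s Ts.
Qed.
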